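(* Let $T$ be a canonical substitutionally closed theory in a language $\mathcal L$ and let $\mathcal N$ be a Euclidean structure in $\mathcal L$. Then $\mathcal N$ is a weak $T$-on if and only if $\lambda(T(F,\mathcal N))=1$ for every axiom $\forall\vec x F(x_1,\dots,x_n)$ of $T$; and $\mathcal N$ is a strong $T$-on if and only if $T(F,\mathcal N)\supseteq\mathcal E_n\setminus\mathcal D_n$ for every axiom $\forall\vec xF(x_1,\dots,x_n)$ of $T$.
   Context: A language $\mathcal L$ is a finite set of predicate symbols $P$ with arities $k(P)\ge1$ (no constants/function symbols; equality allowed). A universal theory is a set of axioms $\forall\vec xF(\vec x)$ with $F$ open. Structures $M$: set $V(M)$ with relations $R_{P,M}\subseteq V(M)^{k(P)}$. $T$ is canonical if it entails $x_i=x_j\to\neg P(x_1,\dots,x_k)$ for each $P$ of arity $k$ and $i<j$; a structure is canonical if no $R_{P,M}$ contains a tuple with repeated entries. For an open formula $F(x_1,\dots,x_n)$ and an equivalence relation $\approx$ on $[n]$ with classes $1,\dots,m$, let $F_\approx(y_1,\dots,y_m)=F(y_{\nu_1},\dots,y_{\nu_n})$ where $\nu_i$ is the class of $i$. $T$ is substitutionally closed if for every axiom $\forall\vec xF(x_1,\dots,x_n)$ and every equivalence relation $\approx$ on $[n]$, $T$ proves $\forall\vec yF_\approx(\vec y)$ using only propositional rules and possibly renaming variables in its axioms (substituting the same variable for two different variables is not allowed). $r(V)$: non-empty finite subsets of $V$; $\mathcal E_V=[0,1]^{r(V)}$ with Lebesgue measure $\lambda$; $\mathcal E_n=\mathcal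 E_{[n]}$; for injective $\alpha:[k]\to V$, $\alpha^*(x)_A=x_{\alpha(A)}$. Diagonal: $\mathcal D_V=\{x:\exists i\ne j,\ x_{\{i\}}=x_{\{j\}}\}$, $\mathcal D_n=\mathcal D_{[n]}$. A Euclidean structure $\mathcal N$ assigns to each $P$ a Lebesgue measurable $\mathcal N_P\subseteq\mathcal E_{k(P)}$. For an open formula $F(x_1,\dots,x_n)$, $T(F,\mathcal N)\subseteq\mathcal E_n$ is defined by: $T(F,\mathcal N)=\emptyset$ if $F$ is $P(x_{i_1},\dots,x_{i_k})$ with $i_1,\dots,i_k$ not pairwise distinct, or if $F$ is $x_i=x_j$ with $i\ne j$; $T(x_i=x_i,\mathcal N)=\mathcal E_n$; if $F$ is $P(x_{i_1},\dots,x_{i_k})$ with pairwise distinct $i_j$, then $T(F,\mathcal N)=(\iota^* )^{-1}(\mathcal N_P)$ where $\iota:[k]\to[n]$, $\iota(j)=i_j$; and $T(\cdot,\mathcal N)$ commutes with propositional connectives (e.g. $T(F_1\lor F_2,\mathcal N)=T(F_1,\mathcal N)\cup T(F_2,\mathcal N)$, $T(\neg F,\mathcal N)=\mathcal E_n\setminus T(F,\mathcal N)$). For a finite structure $M$, $R_P(M)$ (resp. $\overline R_P(M)$) is the set of injections $\alpha:[k(P)]\to V(M)$ with $(\alpha(1),\dots,\alpha(k(P)))\in R_{P,M}$ (resp. $\notin$); $T_{\mathrm{ind}}(M,\mathcal N)=\bigcap_P\big(\bigcap_{\alpha\in R_P(M)}(\alpha^* )^{-1}(\mathcal N_P)\cap\bigcap_{\alpha\in\overline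 R_P(M)}(\alpha^* )^{-1}(\mathcal E_{k(P)}\setminus\mathcal N_P)\big)$. A weak $T$-on: $\lambda(T_{\mathrm{ind}}(M,\mathcal N))=0$ for every finite canonical structure $M$ not a model of $T$; a strong $T$-on: $T_{\mathrm{ind}}(M,\mathcal N)\subseteq\mathcal D_{V(M)}$ for every such $M$. *)

(* Defs.v *)
From HB Require Import structures.
From mathcomp Require Import all_boot all_order all_algebra.
From mathcomp Require Import all_classical all_reals all_analysis.

Set Implicit Arguments.
Unset Strict Implicit.
Unset Printing Implicit Defensive.
Import Order.TTheory GRing.Theory Num.Theory.
Import numFieldNormedType.Exports.

Local Open Scope classical_set_scope.
Local Open Scope ring_scope.

Record language := Language {
  pred_symbol :> finType;
  arity : pred_symbol -> nat;
  arity_gt0 : forall P, (0 < arity P)%N }.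

(** Open formulas with variables in [X]; the tuple (x_{i_1}, ..., x_{i_k}) of
    arguments of a predicate symbol is the function j |-> x_{i_j}. *)
Inductive formula (L : language) (X : Type) : Type :=
| Pred (P : L) (x : 'I_(arity P) -> X)
| Equal (x y : X)
| Not (F : formula L X)
| And (F G : formula L X)
| Or (F G : formula L X)
| Implies (F G : formula L X).
Arguments Pred {L X} P x.
Arguments Equal {L X} x y.

Fixpoint rename (L : language) (X Y : Type) (f : X -> Y) (F : formula L X) :
    formula L Y :=
  match F with
  | Pred P x => Pred P (f \o x)
  | Equal x y => Equal (f x) (f y)
  | Not F => Not (rename f F)
  | And F G => And (rename f F) (rename f G)
  | Or F G => Or (rename f F) (rename f G)
  | Implies F G => Implies (rename f F) (rename f G)
  end.

(** The axiom [forall x_1 ... x_n, F(x_1, ..., x_n)] is the pair of [n] and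
    [F : formula L 'I_n]; the variables x_1, ..., x_n need not all occur in
    [F]. *)
Definition axiom (L : language) := {n : nat & formula L 'I_n}.
Definition theory (L : language) := set (axiom L).

Section semantics.
Variable L : language.

(** A structure with vertex set [V]: each [M P] is a subset of V^k(P). *)
Definition structure (V : Type) := forall P : L, set ('I_(arity P) -> V).

Fixpoint sat (V X : Type) (M : structure V) (v : X -> V) (F : formula L X) :
    Prop :=
  match F with
  | Pred P x => M P (v \o x)
  | Equal x y => v x = v y
  | Not F => ~ sat M v F
  | And F G => sat M v F /\ sat M v G
  | Or F G => sat M v F \/ sat M v G
  | Implies F G => sat M v F -> sat M v G
  end.

Definition is_model (T : theory L) (V : Type) (M : structure V) : Prop :=
  forall ax : axiom L, T ax -> forall v : 'I_(tag ax) -> V, sat M v (tagged ax).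

Definition entails (T : theory L) (X : Type) (F : formula L X) : Prop :=
  forall (V : Type) (M : structure V), is_model T M ->
  forall v : X -> V, sat M v F.

Definition canonical_structure (V : Type) (M : structure V) : Prop :=
  forall (P : L) (a : 'I_(arity P) -> V), M P a -> injective a.

Definition canonical_theory (T : theory L) : Prop :=
  forall (P : L) (i j : 'I_(arity P)), (i < j)%N ->
  entails T (Implies (Equal i j) (Not (Pred P id))).

End semantics.

Section substitution.
Variable L : language.

(** Truth value of [F] under an assignment of truth values to atomic formulas;
    every atom, including every [x = y], is a propositional variable. *)
Fixpoint prop_eval (X : Type) (p : forall P : L, ('I_(arity P) -> X) -> bool)
    (e : X -> X -> bool) (F : formula L X) : bool :=
  match F with
  | Pred P x => p P x
  | Equal x y => e x y
  | Not F => ~~ prop_eval p e F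
  | And F G => prop_eval p e F && prop_eval p e G
  | Or F G => prop_eval p e F || prop_eval p e G
  | Implies F G => prop_eval p e F ==> prop_eval p e G
  end.

Definition tautology (X : Type) (F : formula L X) : Prop :=
  forall p e, prop_eval p e F.

(** Propositional derivations from variants of the axioms of [T]. The variables
    are drawn from [nat], and an axiom may only be renamed injectively, i.e.
    without identifying two of its variables. *)
Inductive prop_derivable (T : theory L) : formula L nat -> Prop :=
| Derivable_axiom (ax : axiom L) (s : 'I_(tag ax) -> nat) :
    T ax -> injective s -> prop_derivable T (rename s (tagged ax))
| Derivable_tautology (F : formula L nat) :
    tautology F -> prop_derivable T F
| Derivable_mp (F G : formula L nat) :
    prop_derivable T (Implies F G) -> prop_derivable T F ->
    prop_derivable T G.

(** [nu] numbers the classes of the equivalence relation [e] by 1, ..., m; then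
    F_e(y_1, ..., y_m) is [rename nu F]. *)
Definition class_numbering (n m : nat) (e : rel 'I_n) (nu : 'I_n -> 'I_m) :
    Prop :=
  (forall y, exists x, nu x = y) /\ (forall x y, e x y = (nu x == nu y)).

Definition substitutionally_closed (T : theory L) : Prop :=
  forall ax : axiom L, T ax ->
  forall e : rel 'I_(tag ax), equivalence_rel e ->
  forall (m : nat) (nu : 'I_(tag ax) -> 'I_m), class_numbering e nu ->
  prop_derivable T (rename (@nat_of_ord m) (rename nu (tagged ax))).

End substitution.

Section unit_interval.
Variable R : realType.
Local Open Scope ereal_scope.

Definition lebesgue01 : set (measurableTypeR R) -> \bar R :=
  mrestr (@lebesgue_measure R) (measurable_itv `[0%R, 1%R]).

HB.instance Definition _ := Measure.on lebesgue01.

Let lebesgue01_setT : lebesgue01 setT = 1.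
Proof.
rewrite /lebesgue01 /mrestr setTI lebesgue_measure_itv /= lte_fin ltr01.
by rewrite EFinN oppe0 adde0.
Qed.

HB.instance Definition _ :=
  Measure_isProbability.Build _ _ _ lebesgue01 lebesgue01_setT.

End unit_interval.

Section cube.
Variable R : realType.
Local Open Scope ereal_scope.
Local Notation mR := (measurableTypeR R).

Definition tcons n (xt : mR * n.-tuple mR) : n.+1.-tuple mR :=
  [tuple of xt.1 :: xt.2].

Lemma measurable_tcons n : measurable_fun setT (@tcons n).
Proof. exact: (measurable_cons measurable_fst measurable_snd). Qed.

Section step.
Variables (n : nat) (mu : probability (n.-tuple mR) R).

Definition cons_measure : set (n.+1.-tuple mR) -> \bar R :=
  pushforward (@lebesgue01 R \x mu) (@tcons n).

Let cons_measure0 : cons_measure set0 = 0.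
Proof. by rewrite /cons_measure /pushforward preimage_set0 measure0. Qed.

Let cons_measure_ge0 A : 0 <= cons_measure A.
Proof. by rewrite /cons_measure /pushforward; apply: measure_ge0. Qed.

Let cons_measure_sigma_additive : semi_sigma_additive cons_measure.
Proof.
move=> F mF tF mUF; rewrite /cons_measure /pushforward preimage_bigcup.
apply: measure_semi_sigma_additive.
- by move=> k; rewrite -[X in measurable X]setTI; exact: measurable_tcons.
- apply/trivIsetP => /= i j _ _ ij; rewrite -preimage_setI.
  by move/trivIsetP : tF => /(_ _ _ _ _ ij) ->//; rewrite preimage_set0.
- by rewrite -preimage_bigcup -[X in measurable X]setTI;
    exact: measurable_tcons.
Qed.

HB.instance Definition _ := isMeasure.Build _ _ _ cons_measure
  cons_measure0 cons_measure_ge0 cons_measure_sigma_additive.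

Let cons_measure_setT : cons_measure setT = 1.
Proof.
by rewrite /cons_measure /pushforward preimage_setT; exact: probability_setT.
Qed.

HB.instance Definition _ :=
  Measure_isProbability.Build _ _ _ cons_measure cons_measure_setT.

End step.

(** The n-fold product of Lebesgue measure on [0, 1], on the product (Borel)
    sigma-algebra of R^n. *)
Fixpoint cube_measure (n : nat) : probability (n.-tuple mR) R :=
  match n with
  | 0 => \d_([tuple] : 0.-tuple mR)
  | k.+1 => cons_measure (cube_measure k)
  end.

Lemma cube_measure_box n (B : 'I_n -> set mR) :
  (forall i, measurable (B i)) ->
  cube_measure n [set t | forall i, B i (tnth t i)] =
  \prod_(i < n) lebesgue_measure (B i `&` `[0%R, 1%R]).
Proof.
elim: n B => [|n IHn] B mB.
  by rewrite big_ord0 /= diracE mem_set// => -[].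
rewrite big_ord_recl -IHn => [|//].
rewrite -[lebesgue_measure _]/(lebesgue01 (B ord0)) -product_measure1E//.
- rewrite /= /cons_measure /pushforward; congr (_ \x _).
  apply/seteqP; split => -[x t] /=.
    by move=> H; split; [exact: (H ord0)|move=> i; have := H (lift ord0 i);
      rewrite tnthS].
  move=> [B0 Bt] i; case: (unliftP ord0 i) => [j|] ->//.
  by rewrite tnthS.
- rewrite [X in measurable X](_ : _ =
    \bigcap_(i in setT) ((@tnth n mR ^~ i) @^-1` B (lift ord0 i))); last first.
    by apply/seteqP; split => t /= H i; [move=> _|]; exact: H.
  apply: fin_bigcap_measurable => // i _.
  by rewrite -[X in measurable X]setTI; exact: measurable_tnth.
Qed.

End cube.

Section euclidean.
Variable R : realType.

(** r(V): the non-empty subsets of a finite set V. *)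
Notation rsub V := {A : {set V} | A != finset.set0}.

(** Points of R^r(V), the coordinates being listed along [enum (rsub V)]. *)
Definition point (V : finType) := #|{: rsub V}|.-tuple (measurableTypeR R).

Definition coord (V : finType) (x : point V) (A : rsub V) : R :=
  tnth x (enum_rank A).

Definition cubeE (V : finType) : set (point V) :=
  [set x | forall A, 0 <= coord x A <= 1].

(** Lebesgue measure on [cubeE V] is the completion of [cube_measure]. *)
Definition lebesgueE (V : finType) : set (point V) -> \bar R :=
  @completed_measure_extension _ _ _ (cube_measure R #|{: rsub V}|).

Definition lebesgue_measurableE (V : finType) (A : set (point V)) : Prop :=
  (mu_ext (cube_measure R #|{: rsub V}|)).-cara.-measurable A.

Lemma rsub1_subproof (V : finType) (i : V) : [set i]%SET != finset.set0.
Proof. by apply/set0Pn; exists i; rewrite inE. Qed.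

Definition rsub1 (V : finType) (i : V) : rsub V :=
  exist _ [set i]%SET (rsub1_subproof i).

Definition diagonalE (V : finType) : set (point V) :=
  [set x | cubeE x /\
           exists i j : V, i != j /\ coord x (rsub1 i) = coord x (rsub1 j)].

Lemma rimage_subproof (U V : finType) (a : U -> V) (A : rsub U) :
  (a @: val A)%SET != finset.set0.
Proof. by rewrite imset_eq0; exact: (valP A). Qed.

Definition rimage (U V : finType) (a : U -> V) (A : rsub U) : rsub V :=
  exist _ (a @: val A)%SET (rimage_subproof a A).

Definition pullback (U V : finType) (a : U -> V) (x : point V) : point U :=
  [tuple coord x (rimage a (enum_val i)) | i < #|{: rsub U}|].

Lemma coord_pullback (U V : finType) (a : U -> V) (x : point V) (A : rsub U) :
  coord (pullback a x) A = coord x (rimage a A).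
Proof. by rewrite /coord /pullback tnth_mktuple enum_rankK. Qed.

Variable L : language.

Record euclidean_structure := EuclideanStructure {
  eucl :> forall P : L, set (point 'I_(arity P));
  eucl_sub : forall P, @eucl P `<=` @cubeE 'I_(arity P);
  eucl_measurable : forall P, lebesgue_measurableE (@eucl P) }.
Arguments eucl N P : rename.

(** The truth set T(F, N). Preimages under a^* : E_V -> E_U are written as
    [cubeE V `&` pullback a @^-1` _], since [pullback a] is defined on all of
    R^r(V). *)
Fixpoint truth_set (n : nat) (F : formula L 'I_n) (N : euclidean_structure) :
    set (point 'I_n) :=
  match F with
  | Pred P i =>
      if injectiveb i then @cubeE 'I_n `&` pullback i @^-1` (N P) else set0
  | Equal i j => if i == j then @cubeE 'I_n else set0
  | Not F => @cubeE 'I_n `\` truth_set F N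
  | And F G => truth_set F N `&` truth_set G N
  | Or F G => truth_set F N `|` truth_set G N
  | Implies F G => (@cubeE 'I_n `\` truth_set F N) `|` truth_set G N
  end.

Definition Tind (V : finType) (M : structure L V) (N : euclidean_structure) :
    set (point V) :=
  @cubeE V `&`
  \bigcap_(P in [set: L])
    (\bigcap_(a in [set a | injective a /\ M P a])
       (pullback a @^-1` (N P)) `&`
     \bigcap_(a in [set a | injective a /\ ~ M P a])
       (pullback a @^-1` (@cubeE 'I_(arity P) `\` N P))).

Definition weak_on (T : theory L) (N : euclidean_structure) : Prop :=
  forall (V : finType) (M : structure L V),
  canonical_structure M -> ~ is_model T M -> lebesgueE (Tind M N) = 0%E.

Definition strong_on (T : theory L) (N : euclidean_structure) : Prop :=
  forall (V : finType) (M : structure L V),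
  canonical_structure M -> ~ is_model T M -> Tind M N `<=` @diagonalE V.

End euclidean.

(* Main.v *)
(** A point x of the cube E_V induces a canonical structure M_x on V, in which
    P(a) holds iff a is injective and a^* x lies in N_P. Then T(F, N) is the set
    of x such that M_x satisfies F at the identity assignment, and T_ind(M, N) is
    the set of x such that M_x = M. Hence both parts of the theorem compare
    "all M_x are models of T" with "the axioms of T hold in all M_x at injective
    assignments", up to an ideal of exceptional points (null sets, resp. subsets
    of the diagonal). An axiom at a non-injective assignment v is the formula
    F_e at an injective one, where e is the kernel of v; F_e is derived
    propositionally from finitely many injective instances of axioms, and the
    exceptional sets of these instances are pullbacks of members of the ideal.
    Since the derivation may use more variables than V has vertices, it is
    interpreted over a larger vertex set, and the conclusion descends to V
    because pullback along an injection preserves Lebesgue measure, resp. because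
    every point off the diagonal extends to a point off the diagonal. *)

Require Import Defs.
From mathcomp Require Import all_boot all_order all_algebra.
From mathcomp Require Import all_classical all_reals all_analysis.
From mathcomp Require Import lra.

Set Implicit Arguments.
Unset Strict Implicit.
Unset Printing Implicit Defensive.
Import Order.TTheory GRing.Theory Num.Theory.

Local Open Scope classical_set_scope.
Local Open Scope ring_scope.

(* MathComp also defines [point] (pointed types) and [coord] (vector spaces). *)
Local Notation point := Defs.point.
Local Notation coord := Defs.coord.

(** * The structure induced by a point *)

Section formulas.
Variable L : language.

Lemma sat_rename (V X Y : Type) (M : structure L V) (f : X -> Y) (v : Y -> V)
  (F : formula L X) : sat M v (rename f F) <-> sat M (v \o f) F.
Proof.
by elim: F => //= [F IH|F IHF G IHG|F IHF G IHG|F IHF G IHG]; tauto.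
Qed.

(** Reading every atom, equalities included, at its actual truth value is one propositional
    assignment; hence tautologies hold in all structures. *)
Lemma sat_prop_eval (V X : Type) (M : structure L V) (v : X -> V)
    (F : formula L X) :
  sat M v F <->
  prop_eval (fun P a => `[< M P (v \o a) >]) (fun x y => `[< v x = v y >]) F.
Proof.
elim: F => /= [P a|x y|F IH|F IHF G IHG|F IHF G IHG|F IHF G IHG].
- by split=> /asboolP.
- by split=> /asboolP.
- by split=> [nF|/negP nF]; [apply/negP|]; tauto.
- by split=> [[? ?]|/andP[? ?]]; [apply/andP|]; tauto.
- by split=> [?|/orP ?]; [apply/orP|]; tauto.
- by split=> [?|/implyP ?]; [apply/implyP|]; tauto.
Qed.

End formulas.

Section points.
Variable R : realType.

Lemma point_ext (V : finType) (x y : point R V) :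
  (forall A, coord x A = coord y A) -> x = y.
Proof.
move=> xy; apply: eq_from_tnth => i.
by have := xy (enum_val i); rewrite /coord enum_valK.
Qed.

Lemma rimage_comp (U V W : finType) (a : V -> W) (b : U -> V) A :
  rimage a (rimage b A) = rimage (a \o b) A.
Proof. by apply: val_inj; rewrite /= imset_comp. Qed.

Lemma rimage_inj (U V : finType) (a : U -> V) :
  injective a -> injective (rimage a).
Proof.
move=> aI A B /(congr1 val)/= /(imset_inj aI) AB; exact: val_inj.
Qed.

Lemma rimage_rsub1 (U V : finType) (a : U -> V) i :
  rimage a (rsub1 i) = rsub1 (a i).
Proof. by apply: val_inj; rewrite /= imset_set1. Qed.

Lemma pullback_comp (U V W : finType) (a : V -> W) (b : U -> V)
  (x : point R W) : pullback b (pullback a x) = pullback (a \o b) x.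
Proof. by apply: point_ext => A; rewrite !coord_pullback rimage_comp. Qed.

Lemma cubeE_pullback (U V : finType) (a : U -> V) (x : point R V) :
  cubeE x -> cubeE (pullback a x).
Proof. by move=> x01 A; rewrite coord_pullback; exact: x01. Qed.

Variables (L : language) (N : euclidean_structure R L).

Definition point_structure (V : finType) (x : point R V) : structure L V :=
  fun P => [set a | injective a /\ N P (pullback a x)].

Lemma canonical_point_structure (V : finType) (x : point R V) :
  canonical_structure (point_structure x).
Proof. by move=> P a []. Qed.

(** Composing with an injection neither creates nor removes repetitions among arguments, and
    reflects equalities, so atoms agree on both sides. *)
Lemma sat_point_structure_pullback (U V : finType) (a : U -> V) X
    (v : X -> U) (F : formula L X) (x : point R V) : injective a ->
  sat (point_structure (pullback a x)) v F <->
  sat (point_structure x) (a \o v) F.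
Proof.
move=> aI.
elim: F => /= [P b|y z|F IH|F IHF G IHG|F IHF G IHG|F IHF G IHG]; try tauto.
- rewrite /point_structure /= pullback_comp.
  split=> -[vbI NP]; split=> //; first exact: (inj_comp aI vbI).
  exact: (@inj_compr _ _ _ a (v \o b)).
- by split=> [->//|/aI].
Qed.

(** The exceptional sets. Unlike in [truth_set], the assignment is arbitrary and may identify
    variables. *)
Definition failure_set (V : finType) X (v : X -> V) (F : formula L X) :
  set (point R V) := [set x | cubeE x /\ ~ sat (point_structure x) v F].

Lemma truth_setE n (F : formula L 'I_n) :
  truth_set F N = [set x | cubeE x /\ sat (point_structure x) id F].
Proof.
elim: F => /= [P b|y z|F ->|F -> G ->|F -> G ->|F -> G ->].
- case: ifPn => [/injectiveP bI|/injectiveP nbI].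
    by apply/seteqP; split=> x /=; rewrite /point_structure /=; tauto.
  by apply/seteqP; split=> x //= -[_ []].
- by case: eqP => yz; apply/seteqP; split=> x //=; tauto.
- by apply/seteqP; split=> x /=; tauto.
- by apply/seteqP; split=> x /=; tauto.
- by apply/seteqP; split=> x /=; tauto.
- apply/seteqP; split=> x /=; first tauto.
  by case=> x01 FG; have [?|?] := pselect (sat (point_structure x) id F); tauto.
Qed.

Lemma truth_setDE n (F : formula L 'I_n) :
  @cubeE R 'I_n `\` truth_set F N = failure_set id F.
Proof.
rewrite truth_setE; apply/seteqP; split=> x [x01 nF]; split=> // Fx; apply: nF.
  by split.
by case: Fx.
Qed.

(** [Tind] constrains [M] only at injective tuples; canonicity settles the remaining ones. *)
Lemma TindP (V : finType) (M : structure L V) x : canonical_structure M ->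
  Tind M N x <-> cubeE x /\ point_structure x = M.
Proof.
move=> Mcan; split=> [[x01 TMx]|[x01 <-]].
- split=> //; apply: functional_extensionality_dep => P.
  have [MP nMP] := TMx P I.
  apply/seteqP; split=> a /=.
    move=> [aI NPa]; apply: contrapT => nMa.
    by have [] := nMP a (conj aI nMa).
  by move=> Ma; split; [exact: Mcan Ma|exact: MP (conj (Mcan _ _ Ma) Ma)].
- split=> // P _; split=> a /= [aI]; first by case.
  by move=> nMa; split; [exact: cubeE_pullback|move=> ?; apply: nMa].
Qed.

End points.

(** * Ideals of sets of points and propositional derivations *)

(* Common properties of the families of null sets and of subsets of the
   diagonal, so that the weak and the strong case are handled at once. *)
Record point_ideal (R : realType) := PointIdeal {
  ideal_mem :> forall V : finType, set (point R V) -> Prop;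
  ideal0 : forall V, ideal_mem (@set0 (point R V));
  idealS : forall V (A B : set (point R V)),
    A `<=` B -> ideal_mem B -> ideal_mem A;
  idealU : forall V (A B : set (point R V)),
    ideal_mem A -> ideal_mem B -> ideal_mem (A `|` B);
  ideal_pullback : forall (U V : finType) (a : U -> V) (A : set (point R U)),
    injective a -> ideal_mem A -> ideal_mem (@cubeE R V `&` pullback a @^-1` A);
  ideal_descend : forall (U V : finType) (a : U -> V) (A : set (point R U)),
    injective a -> lebesgue_measurableE A -> A `<=` @cubeE R U ->
    ideal_mem (@cubeE R V `&` pullback a @^-1` A) -> ideal_mem A }.

Section derivations.
Variables (R : realType) (L : language) (N : euclidean_structure R L).
Variables (T : theory L) (J : point_ideal R).

(** Only the variables of the finitely many axiom instances must be kept apart, so injectivity below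
    a bound [K] suffices; no map from [nat] to a finite [V] is injective everywhere. *)
Lemma ideal_derivable (F : formula L nat) :
  (forall n (G : formula L 'I_n), T (existT _ n G) ->
     J _ (failure_set N id G)) ->
  prop_derivable T F ->
  exists K : nat, forall (V : finType) (u : nat -> V),
    {in gtn K &, injective u} -> J _ (failure_set N u F).
Proof.
move=> JT; elim=> {F} [ax s Tax sI|F tF|F G _ [K1 JFG] _ [K2 JF]].
- exists (\max_i s i).+1 => V u uI.
  have usI : injective (u \o s).
    by move=> i j /= /uI us; apply/sI/us; rewrite inE ltnS; exact: leq_bigmax.
  case: ax s Tax sI uI usI => n G /= s Tax _ _ usI.
  apply: idealS (ideal_pullback usI (JT _ _ Tax)) => x [x01 nG]; split=> //=.
  split; first exact: cubeE_pullback.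
  by rewrite sat_point_structure_pullback// => nG'; apply/nG/sat_rename.
- exists 0%N => V u _; apply: idealS (ideal0 J V) => x [_] /=; apply.
  by apply/sat_prop_eval; exact: tF.
- exists (maxn K1 K2) => V u uI.
  have JFG' : J _ (failure_set N u (Defs.Implies F G)).
    apply: JFG => i j; rewrite !inE => iK jK.
    by apply: uI; rewrite !inE leq_max ?iK ?jK.
  have JF' : J _ (failure_set N u F).
    apply: JF => i j; rewrite !inE => iK jK.
    by apply: uI; rewrite !inE leq_max ?iK ?jK orbT.
  apply: idealS (idealU JFG' JF') => x [x01 nG] /=.
  have [?|?] := pselect (sat (point_structure N x) u F); [left|right]; split=> //=.
  by move=> FG; apply/nG/FG.
Qed.

(** [nu] numbers the classes of the kernel of [v], to which substitutional closure is applied; [w]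
    gives the common value on each class. *)
Lemma factor_image n (V : finType) (v : 'I_n -> V) :
  exists (m : nat) (nu : 'I_n -> 'I_m) (w : 'I_m -> V),
  [/\ forall y, exists x, nu x = y, injective w & w \o nu = v].
Proof.
pose D := [set v x | x in 'I_n]%SET.
have vD x : v x \in D by exact: imset_f.
exists #|D|, (fun x => enum_rank_in (vD x) (v x)), enum_val; split.
- move=> y; have /imsetP[x _ vx] := enum_valP y.
  by exists x; apply: enum_val_inj; rewrite enum_rankK_in.
- exact: enum_val_inj.
- by apply/funext => x /=; rewrite enum_rankK_in.
Qed.

(* A propositional derivation of [F] with variables identified along [v] may
   use more variables than [V] has vertices, and the axioms are only known to
   hold for injective assignments: hence the spare vertices ['I_K.+1]. *)
Lemma ideal_axiom n (F : formula L 'I_n) (V : finType) (v : 'I_n -> V) :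
  substitutionally_closed T -> T (existT _ n F) ->
  (forall (V : finType) n (v : 'I_n -> V) (G : formula L 'I_n),
     lebesgue_measurableE (failure_set N v G)) ->
  (forall n (G : formula L 'I_n), T (existT _ n G) ->
     J _ (failure_set N id G)) ->
  J _ (failure_set N v F).
Proof.
move=> Tsub TF mfail JT.
have [m [nu [w [nu_surj wI wnu]]]] := factor_image v.
pose e := [rel x y | nu x == nu y].
have eqv : equivalence_rel e.
  by move=> x y z /=; split=> // /eqP ->.
have [|K JK] := ideal_derivable JT (Tsub _ TF e eqv m nu _); first by split.
(* Variables below [m] stand for classes and go to their vertices; all others go to spare vertices.
   The default of [inord] only affects variables above [K]. *)
pose u i : (V + 'I_K.+1)%type :=
  if insub i is Some j then inl (w j) else inr (inord i).
have uI : {in gtn K &, injective u}.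
  move=> i j; rewrite !inE /u => iK jK.
  case: insubP => [i' _ i'i|_]; case: insubP => [j' _ j'j|_] //.
  - by case=> /wI ij; rewrite -i'i -j'j ij.
  - by case=> /(congr1 (@nat_of_ord _)); rewrite !inordK// ltnW.
have inlI : injective (@inl V 'I_K.+1) by move=> ? ? [].
apply: (ideal_descend inlI) => //; [by move=> x []|].
apply: idealS (JK _ u uI) => x [x01 [_ nF]]; split=> //.
rewrite !sat_rename => uF; apply: nF.
rewrite sat_point_structure_pullback//.
suff <- : (u \o @nat_of_ord m) \o nu = inl \o v by [].
by apply/funext => i /=; rewrite /u valK -wnu.
Qed.

(** A non-model violates some axiom at some assignment, and all points of [Tind M N] induce [M],
    hence lie in that failure set. *)
Lemma ideal_Tind (V : finType) (M : structure L V) :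
  substitutionally_closed T ->
  (forall (V : finType) n (v : 'I_n -> V) (G : formula L 'I_n),
     lebesgue_measurableE (failure_set N v G)) ->
  (forall n (G : formula L 'I_n), T (existT _ n G) ->
     J _ (failure_set N id G)) ->
  canonical_structure M -> ~ is_model T M -> J _ (Tind M N).
Proof.
move=> Tsub mfail JT Mcan nM.
have [[n F] TF [v nF]] : exists2 ax, T ax &
    exists v : 'I_(tag ax) -> V, ~ sat M v (tagged ax).
  apply: contrapT => noF; apply: nM => ax Tax v; apply: contrapT => nF.
  by apply: noF; exists ax => //; exists v.
apply: idealS (ideal_axiom v Tsub TF mfail JT) => x /(TindP N x Mcan)[x01 xM].
by split=> //; rewrite xM.
Qed.

End derivations.

(** * Outer measures and measure-preserving maps *)

Section outer_probability.
Local Open Scope ereal_scope.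
Context d (T : measurableType d) (R : realType) (mu : probability T R).
Local Notation "mu^*" := (mu_ext mu).

Lemma mu_extT : mu^* setT = 1.
Proof. by rewrite (measurable_mu_extE mu)//; exact: probability_setT. Qed.

Lemma mu_ext_fin_num A : mu^* A \is a fin_num.
Proof.
rewrite ge0_fin_numE ?mu_ext_ge0//.
by apply: (@le_lt_trans _ _ (mu^* setT)); [exact: le_mu_ext|rewrite mu_extT ltry].
Qed.

Lemma mu_ext_caraC (A : set T) : mu^*.-caratheodory A -> mu^* A + mu^* (~` A) = 1.
Proof. by move=> /(_ setT); rewrite !setTI mu_extT. Qed.

(* For a measurable B, additivity of mu^* along B and ~` B leaves no slack in the
   two subadditivity inequalities; a general set is then covered by such a B. *)
Lemma caratheodory_probability A :
  mu^* A + mu^* (~` A) <= 1 -> mu^*.-caratheodory A.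
Proof.
move=> A1.
have mA B : measurable B -> mu^* (B `&` A) + mu^* (B `&` ~` A) = mu B.
  move=> mB.
  have cB : mu^*.-caratheodory B by exact: caratheodory_measurable_mu_ext.
  have BA : mu^* A = mu^* (B `&` A) + mu^* (~` B `&` A).
    by rewrite (cB A) !(setIC A).
  have BnA : mu^* (~` A) = mu^* (B `&` ~` A) + mu^* (~` B `&` ~` A).
    by rewrite (cB (~` A)) !(setIC (~` A)).
  have leB C : mu^* C <= mu^* (C `&` A) + mu^* (C `&` ~` A).
    exact: le_outer_measureIC.
  have := leB B; have := leB (~` B); have := mu_ext_caraC cB.
  move: A1; rewrite BA BnA -(measurable_mu_extE mu mB).
  have := mu_ext_fin_num B; have := mu_ext_fin_num (~` B).
  have := mu_ext_fin_num (B `&` A); have := mu_ext_fin_num (B `&` ~` A).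
  have := mu_ext_fin_num (~` B `&` A); have := mu_ext_fin_num (~` B `&` ~` A).
  do 6 (case: (mu^* _) => // ? _).
  rewrite -!EFinD !lee_fin => h1 [h2] h3 h4; congr EFin; lra.
apply: le_caratheodory_measurable => X.
apply: le_ereal_inf_tmp => _ [B [mB XB] <-].
have mUB : measurable (\bigcup_k B k) by exact: bigcup_measurable.
apply: (@le_trans _ _ (mu (\bigcup_k B k))).
  by rewrite -mA//; apply: leeD; apply: le_mu_ext; exact: setSI.
exact: measure_sigma_subadditive.
Qed.

End outer_probability.

Section measure_preserving.
Local Open Scope ereal_scope.
Context d1 d2 (T1 : measurableType d1) (T2 : measurableType d2) (R : realType).
Variables (mu : probability T1 R) (nu : probability T2 R) (f : T1 -> T2).
Hypothesis mf : measurable_fun setT f.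
Hypothesis fmu : forall B, measurable B -> mu (f @^-1` B) = nu B.

(** A measurable cover pulls back to one of the same total measure. *)
Lemma mu_ext_preimage_le A : mu_ext mu (f @^-1` A) <= mu_ext nu A.
Proof.
apply: le_ereal_inf_tmp => _ [B [mB AB] <-].
apply: ereal_inf_lbound; exists (fun k => f @^-1` B k).
  split=> [k|x /AB[k _ Bk]]; last by exists k.
  by rewrite -[X in measurable X]setTI; exact: mf.
by apply: eq_eseriesr => k _; exact: fmu.
Qed.

(** Outer measure cannot grow for [A] or for its complement, yet the two preimages still total at
    least 1, so nothing is lost. *)
Lemma mu_ext_preimage A : (mu_ext nu).-caratheodory A ->
  mu_ext mu (f @^-1` A) = mu_ext nu A.
Proof.
move=> /mu_ext_caraC; have := mu_ext_preimage_le A.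
have := mu_ext_preimage_le (~` A).
have : mu_ext mu setT <=
    mu_ext mu (setT `&` f @^-1` A) + mu_ext mu (setT `&` ~` (f @^-1` A)).
  exact: le_outer_measureIC.
rewrite !setTI mu_extT -preimage_setC.
have := mu_ext_fin_num nu A; have := mu_ext_fin_num nu (~` A).
have := mu_ext_fin_num mu (f @^-1` A).
have := mu_ext_fin_num mu (f @^-1` (~` A)).
case: (mu_ext mu _) => // ? _; case: (mu_ext mu _) => // ? _.
case: (mu_ext nu _) => // ? _; case: (mu_ext nu _) => // ? _.
rewrite -!EFinD !lee_fin => h1 h2 h3 [h4]; congr EFin; lra.
Qed.

(** Measurability reduces to a bound on the outer measures of a set and its complement, and
    preimages only lower both. *)
Lemma cara_preimage A : (mu_ext nu).-caratheodory A ->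
  (mu_ext mu).-caratheodory (f @^-1` A).
Proof.
move=> cA; apply: caratheodory_probability.
by rewrite -(mu_ext_caraC cA) preimage_setC; apply: leeD; exact: mu_ext_preimage_le.
Qed.

End measure_preserving.

(** * Selecting distinct coordinates preserves the cube measure *)

Section coordinate_selection.
Variable R : realType.
Local Open Scope ereal_scope.
Local Notation mR := (measurableTypeR R).

Definition box n (B : 'I_n -> set mR) : set (n.-tuple mR) :=
  [set t | forall i, B i (tnth t i)].

(** The pi-system on which the two measures are compared. *)
Definition boxes n : set (set (n.-tuple mR)) :=
  [set A | exists2 B, (forall i, measurable (B i)) & A = box B].

Lemma measurable_box n (B : 'I_n -> set mR) :
  (forall i, measurable (B i)) -> measurable (box B).
Proof.
move=> mB; rewrite [X in measurable X](_ : _ =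
    \bigcap_(i in setT) ((@tnth n mR ^~ i) @^-1` B i)); last first.
  by apply/seteqP; split => t /= H i; [move=> _|]; exact: H.
apply: fin_bigcap_measurable => // i _.
by rewrite -[X in measurable X]setTI; exact: measurable_tnth.
Qed.

Lemma boxes_generate n : @measurable _ (n.-tuple mR) = <<s @boxes n >>.
Proof.
apply/seteqP; split.
  apply: smallest_sub; first exact: smallest_sigma_algebra.
  move=> A; rewrite -bigcup_seq /= => -[i _ [B mB <-]].
  apply: sub_sigma_algebra.
  exists (fun j => if j == i then B else setT).
    by move=> j; case: ifP.
  apply/seteqP; split=> t /=.
    by move=> [_ Bt] j /=; case: eqP => // ->.
  by move=> /(_ i); rewrite eqxx.
apply: smallest_sub; first exact: sigma_algebra_measurable.
by move=> _ [B mB ->]; exact: measurable_box.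
Qed.

Lemma boxesI n : setI_closed (@boxes n).
Proof.
move=> _ _ [B mB ->] [C mC ->]; exists (fun i => B i `&` C i).
  by move=> i; exact: measurableI.
apply/seteqP; split=> t /=; first by move=> [Bt Ct] i; split.
by move=> BCt; split=> i; case: (BCt i).
Qed.

Variables (p q : nat) (f : 'I_p -> 'I_q).

Definition select (t : q.-tuple mR) : p.-tuple mR :=
  [tuple tnth t (f i) | i < p].

Lemma measurable_select : measurable_fun setT select.
Proof.
apply/measurable_fun_tnthP => i.
rewrite (_ : _ \o _ = @tnth q mR ^~ (f i)); first exact: measurable_tnth.
by apply/funext => t /=; rewrite tnth_mktuple.
Qed.

Lemma cube_measure_select (A : set (p.-tuple mR)) :
  injective f -> measurable A ->
  cube_measure R q (select @^-1` A) = cube_measure R p A.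
Proof.
move=> fI mA.
pose X : {mfun (q.-tuple mR) >-> (p.-tuple mR)} :=
  mfun_Sub (mem_set measurable_select).
apply: (measure_unique (@boxes p) (fun=> setT) (@boxes_generate p) (@boxesI p)
  _ _ (distribution (cube_measure R q) X) (cube_measure R p)) => //.
- move=> _; exists (fun=> setT) => //.
  by apply/seteqP; split.
- by apply/seteqP; split=> // t _; exists 0%N.
- move=> _ [B mB ->]; apply: etrans (esym (cube_measure_box mB)).
  (* [C (f i)] is [B i]; off the image of [f] the intersection is empty, so [C j] is the whole line
     and contributes a factor 1. *)
  pose C j := \bigcap_(i in [set i | f i = j]) B i.
  have fBC : select @^-1` box B = box C.
    apply/seteqP; split=> t /=.
      by move=> Bt j i /= <-; have := Bt i; rewrite tnth_mktuple.
    by move=> Ct i; rewrite tnth_mktuple; exact: Ct.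
  apply: (etrans (congr1 (cube_measure R q) fBC)).
  rewrite cube_measure_box; last first.
    by move=> j; apply: fin_bigcap_measurable => // i _; exact: mB.
  have Cf i : C (f i) = B i.
    by apply/seteqP; split=> x; [apply|move=> Bx k /= /fI ->].
  rewrite (bigID (mem (f @: 'I_p)%SET))/= [X in _ * X]big1 ?mule1; last first.
    move=> j jf; rewrite [C j](_ : _ = setT) ?setTI.
      by rewrite lebesgue_measure_itv /= lte_fin ltr01 oppr0 adde0.
    apply/seteqP; split=> // x _ i /= fij.
    by move: jf; rewrite -fij imset_f.
  rewrite big_imset /=; last by move=> ? ? _ _; exact: fI.
  by apply: eq_big => [i|i _]; rewrite ?inE// Cf.
- by move=> _; rewrite (le_lt_trans (probability_le1 _ _))// ?ltry.
Qed.

End coordinate_selection.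

(** * The ideal of null sets *)

Section null_ideal.
Variable R : realType.
Local Open Scope ereal_scope.

Lemma lebesgueE_ge0 (V : finType) (A : set (point R V)) : 0 <= lebesgueE A.
Proof. exact: mu_ext_ge0. Qed.

Lemma le_lebesgueE (V : finType) (A B : set (point R V)) :
  A `<=` B -> lebesgueE A <= lebesgueE B.
Proof. exact: le_mu_ext. Qed.

Lemma lebesgueEU (V : finType) (A B : set (point R V)) :
  lebesgueE (A `|` B) <= lebesgueE A + lebesgueE B.
Proof. exact: outer_measureU2. Qed.

Lemma lebesgueE_fin_num (V : finType) (A : set (point R V)) :
  lebesgueE A \is a fin_num.
Proof. exact: mu_ext_fin_num. Qed.

Lemma lebesgueE_setC (V : finType) (A : set (point R V)) :
  lebesgue_measurableE A -> lebesgueE A + lebesgueE (~` A) = 1.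
Proof. exact: mu_ext_caraC. Qed.

Lemma lebesgueE_null_sub (V : finType) (A B : set (point R V)) :
  A `<=` B -> lebesgueE B = 0 -> lebesgueE A = 0.
Proof.
move=> AB B0; apply/eqP; rewrite eq_le lebesgueE_ge0 andbT -B0.
exact: le_lebesgueE.
Qed.

Lemma lebesgueE_nullU (V : finType) (A B : set (point R V)) :
  lebesgueE A = 0 -> lebesgueE B = 0 -> lebesgueE (A `|` B) = 0.
Proof.
move=> A0 B0; apply/eqP; rewrite eq_le lebesgueE_ge0 andbT.
by rewrite (le_trans (lebesgueEU A B))// A0 B0 adde0.
Qed.

Lemma cubeE_box (V : finType) : @cubeE R V = box (fun=> `[0%R, 1%R]%classic).
Proof.
apply/seteqP; split=> x /= x01 i.
  by have := x01 (enum_val i); rewrite /Defs.coord enum_valK /= in_itv.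
by have := x01 (enum_rank i); rewrite /= in_itv.
Qed.

Lemma lebesgueE_cubeE (V : finType) : lebesgueE (@cubeE R V) = 1.
Proof.
rewrite cubeE_box /lebesgueE /completed_measure_extension measurable_mu_extE.
  apply: etrans (cube_measure_box _) _; first by move=> _; exact: measurable_itv.
  rewrite big1// => i _.
  by rewrite setIid lebesgue_measure_itv /= lte_fin ltr01 oppr0 adde0.
by apply: measurable_box => _; exact: measurable_itv.
Qed.

Lemma lebesgue_measurableE_cubeE (V : finType) :
  lebesgue_measurableE (@cubeE R V).
Proof.
rewrite cubeE_box; apply: caratheodory_measurable_mu_ext.
by apply: measurable_box => _; exact: measurable_itv.
Qed.

Lemma lebesgueE_setC_cubeE (V : finType) : lebesgueE (~` @cubeE R V) = 0.
Proof.
have := lebesgueE_setC (@lebesgue_measurableE_cubeE V).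
rewrite lebesgueE_cubeE; have := lebesgueE_fin_num (~` @cubeE R V).
by case: lebesgueE => // r _ [] h; congr EFin; lra.
Qed.

Section pullback.
Variables (U V : finType) (a : U -> V).
Hypothesis aI : injective a.

(** In enumerated coordinates, [pullback a] is [select f]. *)
Let f (i : 'I_#|{: {A : {set U} | A != finset.set0}}|) :=
  enum_rank (rimage a (enum_val i)).

Let fI : injective f.
Proof. by move=> i j /enum_rank_inj /(rimage_inj aI) /enum_val_inj. Qed.

Lemma measurable_pullback : measurable_fun setT (@pullback R _ _ a).
Proof. exact: (measurable_select f). Qed.

Lemma cube_measure_pullback B : measurable B ->
  cube_measure R _ (pullback a @^-1` B) = cube_measure R _ B.
Proof. exact: (cube_measure_select fI). Qed.

Lemma lebesgueE_pullback_le (A : set (point R U)) :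
  lebesgueE (pullback a @^-1` A) <= lebesgueE A.
Proof.
exact: (mu_ext_preimage_le measurable_pullback cube_measure_pullback).
Qed.

Lemma lebesgueE_pullback (A : set (point R U)) : lebesgue_measurableE A ->
  lebesgueE (pullback a @^-1` A) = lebesgueE A.
Proof.
exact: (mu_ext_preimage measurable_pullback cube_measure_pullback).
Qed.

Lemma lebesgue_measurableE_pullback (A : set (point R U)) :
  lebesgue_measurableE A -> lebesgue_measurableE (pullback a @^-1` A).
Proof.
exact: (cara_preimage measurable_pullback cube_measure_pullback).
Qed.

End pullback.

Definition null_ideal : point_ideal R.
Proof.
refine (@PointIdeal R (fun V A => lebesgueE A = 0) _ _ _ _ _).
- by move=> V; exact: (outer_measure0 (mu_ext (cube_measure R _))).
- exact: lebesgueE_null_sub.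
- exact: lebesgueE_nullU.
- move=> U V a A aI A0; apply: (@lebesgueE_null_sub _ _ (pullback a @^-1` A)).
    exact: subIsetr.
  apply/eqP; rewrite eq_le lebesgueE_ge0 andbT -A0.
  exact: lebesgueE_pullback_le.
(* Measurability makes the preimage as large as [A]; the hypothesis bounds it inside the cube, and
   outside the cube everything is null. *)
- move=> U V a A aI mA _ A0; rewrite -(lebesgueE_pullback aI mA).
  apply: lebesgueE_null_sub (lebesgueE_nullU A0 (lebesgueE_setC_cubeE V)).
  by move=> x Ax; have [?|?] := pselect (cubeE x); [left|right].
Defined.

Variables (L : language) (N : euclidean_structure R L).

(** Within the cube, satisfaction is a Boolean combination of pullbacks of the sets [N P] and of
    trivial sets. *)
Lemma lebesgue_measurableE_failure_set (V : finType) X (v : X -> V)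
  (F : formula L X) : lebesgue_measurableE (failure_set N v F).
Proof.
apply: caratheodory_measurable_setI; first exact: lebesgue_measurableE_cubeE.
apply: caratheodory_measurable_setC.
elim: F => /= [P b|y z|F IH|F IHF G IHG|F IHF G IHG|F IHF G IHG].
- have [vbI|nvbI] := pselect (injective (v \o b)).
    rewrite [X in caratheodory_measurable _ X](_ : _ = pullback (v \o b) @^-1` N P).
      exact: (lebesgue_measurableE_pullback vbI (eucl_measurable N (P := P))).
    by apply/seteqP; split=> x //= -[].
  rewrite [X in caratheodory_measurable _ X](_ : _ = set0).
    exact: caratheodory_measurable_set0.
  by apply/seteqP; split=> x //= -[].
- have [vyz|nvyz] := pselect (v y = v z).
    rewrite [X in caratheodory_measurable _ X](_ : _ = ~` set0).
      exact/caratheodory_measurable_setC/caratheodory_measurable_set0.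
    by rewrite setC0; apply/seteqP; split.
  rewrite [X in caratheodory_measurable _ X](_ : _ = set0).
    exact: caratheodory_measurable_set0.
  by apply/seteqP; split=> x //=.
- exact: caratheodory_measurable_setC.
- exact: caratheodory_measurable_setI.
- exact: caratheodory_measurable_setU.
- rewrite [X in caratheodory_measurable _ X](_ : _ =
      ~` [set x | sat (point_structure N x) v F] `|`
         [set x | sat (point_structure N x) v G]).
    by apply: caratheodory_measurable_setU => //; exact: caratheodory_measurable_setC.
  apply/seteqP; split=> x /=; last by case.
  by move=> FG; have [/FG|] := pselect (sat (point_structure N x) v F); [right|left].
Qed.

(** Truth set and failure set partition the cube, whose complement is null. *)
Lemma lebesgueE_truth_set1 n (F : formula L 'I_n) :
  lebesgueE (truth_set F N) = 1 <-> lebesgueE (failure_set N id F) = 0.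
Proof.
set B := failure_set _ _ _.
have AB : ~` B = truth_set F N `|` ~` @cubeE R 'I_n.
  rewrite /B -truth_setDE setCD setUC; congr (_ `|` _).
have le1 : lebesgueE (truth_set F N) <= 1.
  rewrite -(lebesgueE_cubeE 'I_n); apply: le_lebesgueE.
  by rewrite truth_setE => x [].
have := lebesgueE_setC (lebesgue_measurableE_failure_set id F); rewrite -/B.
have leAB : lebesgueE (truth_set F N) <= lebesgueE (~` B).
  by apply: le_lebesgueE; rewrite AB; exact: subsetUl.
have leBA : lebesgueE (~` B) <= lebesgueE (truth_set F N).
  rewrite AB (le_trans (lebesgueEU _ _))//.
  by rewrite lebesgueE_setC_cubeE adde0.
have -> : lebesgueE (~` B) = lebesgueE (truth_set F N).
  by apply/eqP; rewrite eq_le leAB leBA.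
have := lebesgueE_fin_num (truth_set F N); have := lebesgueE_fin_num B.
case: (lebesgueE B) => // r _; case: lebesgueE => // s _.
by rewrite -EFinD => -[rs]; split=> -[h]; congr EFin; lra.
Qed.

(** There are only finitely many structures on ['I_n], so the failure set is covered by finitely
    many null sets [Tind M N] with [M] a canonical non-model. *)
Lemma weak_on_failure_set (T : theory L) n (F : formula L 'I_n) :
  weak_on T N -> T (existT _ n F) -> lebesgueE (failure_set N id F) = 0.
Proof.
move=> Tweak TF.
(* Structures do not form a finite type; finite sets of tagged tuples code them, so that a finite
   union can be taken. *)
pose decode (c : {set {P : L & {ffun 'I_(arity P) -> 'I_n}}}) : structure L 'I_n :=
  fun P => [set a | Tagged (fun P => {ffun 'I_(arity P) -> 'I_n}) (finfun a) \in c].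
pose bad c := `[< canonical_structure (decode c) /\ ~ is_model T (decode c) >].
apply: (@lebesgueE_null_sub _ _ (\big[setU/set0]_(c | bad c) Tind (decode c) N)).
  move=> x [x01 nF].
  pose c := [set t : {P : L & {ffun 'I_(arity P) -> 'I_n}} |
    `[< point_structure N x (tagged t : _ -> _) >]]%SET.
  have xc : point_structure N x = decode c.
    apply: functional_extensionality_dep => P; apply/seteqP.
    have ffE (a : 'I_(arity P) -> 'I_n) : (finfun a : _ -> _) = a.
      by apply/funext => i; rewrite ffunE.
    by split=> a; rewrite /decode /= inE /= ffE => /asboolP.
  have badc : bad c.
    apply/asboolP; rewrite -xc; split; first exact: canonical_point_structure.
    by move=> /(_ _ TF id).
  rewrite -bigcup_seq_cond; exists c; first by rewrite /= mem_index_enum.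
  by apply/TindP; [rewrite -xc; exact: canonical_point_structure|].
apply: (big_ind (fun A : set (point R 'I_n) => lebesgueE A = 0)).
- exact: (ideal0 null_ideal).
- exact: lebesgueE_nullU.
- by move=> c /asboolP[can nmod]; exact: Tweak.
Qed.

End null_ideal.

(** * The ideal of subsets of the diagonal *)

Section diagonal_ideal.
Variable R : realType.

(** Supplies coordinates for the vertices outside the image of an injection. *)
Lemma fresh_coordinates (U W : finType) (x : U -> R) :
  exists c : W -> R,
    [/\ injective c, forall k, 0 <= c k <= 1 & forall k i, c k <> x i].
Proof.
pose e := \big[Num.min/1]_(i | 0 < x i) x i.
have e_gt0 : 0 < e by apply: lt_bigmin.
have e_le1 : e <= 1 by exact: bigmin_le_id.
(* [e] is the least positive value of [x], capped at 1. Denominators start at 2, so the new values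
   lie strictly between 0 and [e]. *)
exists (fun k => e / (enum_rank k + 2)%:R); split.
- move=> i j /(mulfI (lt0r_neq0 e_gt0)) /invr_inj /eqP.
  by rewrite eqr_nat eqn_add2r => /eqP /val_inj /enum_rank_inj.
- move=> k; apply/andP; split; first by rewrite divr_ge0// ltW.
  rewrite ler_pdivrMr ?ltr0n ?addn2// mul1r.
  by rewrite (le_trans e_le1)// ler1n.
- move=> k i ki.
  have xi : 0 < x i by rewrite -ki divr_gt0// ltr0n addn2.
  have : e <= x i by exact: bigmin_le_cond.
  rewrite -ki leNgt ltr_pdivrMr ?ltr0n ?addn2// ltr_pMr//.
  by rewrite ltr1n.
Qed.

Lemma extend_off_diagonal (U V : finType) (a : U -> V) (x : point R U) :
  injective a -> cubeE x -> ~ diagonalE x ->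
  exists y : point R V, [/\ cubeE y, ~ diagonalE y & pullback a y = x].
Proof.
move=> aI x01 nDx.
have [c [cI c01 cx]] := fresh_coordinates V (fun i => coord x (rsub1 i)).
(* Copy [x] on the image, use fresh values at the other singletons, and 0 at the remaining
   coordinates, which the diagonal does not see. *)
pose g B := if [pick A | rimage a A == B] is Some A then coord x A
  else if [pick j | rsub1 j == B] is Some j then c j else 0.
pose y : point R V := [tuple g (enum_val i) | i < _].
have yE B : coord y B = g B by rewrite /Defs.coord tnth_mktuple enum_rankK.
have rsub1I W : injective (@rsub1 W).
  by move=> i j /(congr1 val) /set1_inj.
have ax A : coord y (rimage a A) = coord x A.
  rewrite yE /g; case: pickP => [B /eqP/(rimage_inj aI) -> //|/(_ A)].
  by rewrite eqxx.
have y1 i : (exists2 i0, a i0 = i & coord y (rsub1 i) = coord x (rsub1 i0)) \/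
    coord y (rsub1 i) = c i.
  have [[i0 ai]|nai] := pselect (exists i0, a i0 = i).
    by left; exists i0 => //; rewrite -ax rimage_rsub1 ai.
  right; rewrite yE /g; case: pickP => [A /eqP/(congr1 val)/= aAi|_].
    have /set0Pn[i0 Ai0] := valP A.
    case: nai; exists i0; apply/set1P; rewrite -aAi; exact: imset_f.
  case: pickP => [j /eqP/rsub1I -> //|/(_ i)].
  by rewrite eqxx.
exists y; split.
- move=> B; rewrite yE /g; case: pickP => [A _|_]; first exact: x01.
  by case: pickP => [j _|_]; [exact: c01|rewrite lexx ler01].
- case=> _ [i [j [ij]]].
  have [[i0 ai ->]|->] := y1 i; have [[j0 aj ->]|->] := y1 j.
  + move=> xij; apply: nDx; split=> //; exists i0, j0; split=> //.
    by apply: contra_neq ij => i0j0; rewrite -ai -aj i0j0.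
  + by move=> /esym /cx.
  + by move=> /cx.
  + by move=> /cI /eqP; rewrite (negbTE ij).
- by apply: point_ext => A; rewrite coord_pullback ax.
Qed.

Definition diagonal_ideal : point_ideal R.
Proof.
refine (@PointIdeal R (fun V A => A `<=` @diagonalE R V) _ _ _ _ _).
- by [].
- by move=> V A B; exact: subset_trans.
- by move=> V A B AD BD x [/AD|/BD].
- move=> U V a A aI AD x [x01 /AD[_ [i [j [ij]]]]].
  rewrite !coord_pullback !rimage_rsub1 => xij.
  by split=> //; exists (a i), (a j); split=> //; rewrite inj_eq.
- move=> U V a A aI _ Acube AD x Ax; apply: contrapT => nDx.
  have [y [y01 nDy yx]] := extend_off_diagonal aI (Acube _ Ax) nDx.
  by apply/nDy/AD; split=> //=; rewrite yx.
Defined.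

End diagonal_ideal.

Theorem theorem3p10 (R : realType) (L : language) (T : theory L)
  (N : euclidean_structure R L) :
  canonical_theory T -> substitutionally_closed T ->
  (weak_on T N <->
     forall (n : nat) (F : formula L 'I_n), T (existT _ n F) ->
     lebesgueE (truth_set F N) = 1%E) /\
  (strong_on T N <->
     forall (n : nat) (F : formula L 'I_n), T (existT _ n F) ->
     @cubeE R 'I_n `\` @diagonalE R 'I_n `<=` truth_set F N).
Proof.
move=> _ Tsub; split; split.
- move=> Tweak n F TF; apply/lebesgueE_truth_set1.
  exact: weak_on_failure_set Tweak TF.
- move=> T1 V M; apply: (ideal_Tind (J := null_ideal R)) => //.
    by move=> *; exact: lebesgue_measurableE_failure_set.
  by move=> n F /T1 /lebesgueE_truth_set1.
(* A point where [F] fails lies in [Tind] of its own induced structure, which is a canonical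
   non-model. *)
- move=> Tstrong n F TF x [x01 nDx]; rewrite truth_setE; split=> //.
  apply: contrapT => nF; apply: nDx.
  apply: (Tstrong _ (point_structure N x)).
  + exact: canonical_point_structure.
  + by move=> /(_ _ TF id).
  + by apply/TindP; [exact: canonical_point_structure|].
- move=> T1 V M; apply: (ideal_Tind (J := diagonal_ideal R)) => //.
    by move=> *; exact: lebesgue_measurableE_failure_set.
  move=> n F TF x [x01 nF]; apply: contrapT => nDx; apply: nF.
  by have := T1 n F TF x (conj x01 nDx); rewrite truth_setE => -[].
Qed.
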